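(* Let $v^*\in\Delta$ be a linearly stable equilibrium. Then almost surely on the event $\{\lim_{n\to\infty}v_n=v^*\}$, the set $E\setminus\mathrm{supp}(v^* )$ is visited by $(X_n)$ only finitely many times.
   Context: Let $N\ge2$, $E=\{1,\dots,N\}$, $\alpha>1$, and let $A=(A_{i,j})_{i,j\le N}$ be a symmetric matrix with nonnegative entries, $A_{i,j}>0$ for $i\ne j$, and $\sum_j A_{i,j}$ independent of $i$. Let $(X_n)_{n\ge0}$ be a process on $E$ with arbitrary initial state such that, with $\mathcal F_n=\sigma(X_k;k\le n)$ and $Z_n(j)=\sum_{\ell=0}^n\mathbf 1_{\{X_\ell=j\}}$, $\mathbb P(X_{n+1}=j\mid\mathcal F_n)=\dfrac{A_{X_n,j}(1+Z_n(j))^\alpha}{\sum_{k\le N}A_{X_n,k}(1+Z_n(k))^\alpha}$, and let $v_n(i)=Z_n(i)/(n+1)$. Let $\Delta=\{v\in\mathbb R_+^N:\ \sum_i v_i=1,\ v_i\le 3/4 \text{ whenever } A_{i,i}=0\}$. For $v$ with nonnegative coordinates let $v^\alpha=(v_i^\alpha)_i$, $H(v)=\sum_{i,j}A_{i,j}v_i^\alpha v_j^\alpha$, $\pi_i(v)=v_i^\alpha(Av^\alpha)_i/H(v)$, and on $\Delta$ let $F(v)=-v+\pi(v)$. An equilibrium is $v\in\Delta$ with $F(v)=0$; with $DF(v)$ the differential at $v$ of $v\mapsto -v+\pi(v)$ acting on $\{x:\sum_ix_i=0\}$, an equilibrium is linearly stable if all eigenvalues of $DF(v)$ have negative real parts.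 $\mathrm{supp}(v)=\{i:v_i\ne0\}$. *)

(* Defs.v *)
From HB Require Import structures.
From mathcomp Require Import all_boot all_order all_algebra.
From mathcomp Require Import all_classical all_reals all_analysis.
Set Implicit Arguments. Unset Strict Implicit. Unset Printing Implicit Defensive.
Import Order.TTheory GRing.Theory Num.Theory.
Import numFieldNormedType.Exports.
Local Open Scope classical_set_scope.
Local Open Scope ring_scope.

Section VRRW.
Variables (R : realType) (N : nat) (alpha : R) (A : 'M[R]_N).

Definition crd (v : 'rV[R]_N) (i : 'I_N) : R := v ord0 i.

(* v_i^alpha; we use |v_i|^alpha, which coincides with v_i^alpha for v_i >= 0
   and gives a C^1 extension of pi to all of R^N (alpha > 1), so that the
   differential of -v + pi(v) makes sense also at boundary points. *)
Definition vpow (v : 'rV[R]_N) (i : 'I_N) : R := (`|crd v i|) `^ alpha.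

Definition Hfun (v : 'rV[R]_N) : R :=
  \sum_(i < N) \sum_(j < N) A i j * vpow v i * vpow v j.

Definition pi_vec (v : 'rV[R]_N) : 'rV[R]_N :=
  \row_(i < N) (vpow v i * (\sum_(j < N) A i j * vpow v j) / Hfun v).

Definition Ffun (v : 'rV[R]_N) : 'rV[R]_N := - v + pi_vec v.

Definition in_Delta (v : 'rV[R]_N) : Prop :=
  (forall i, 0 <= crd v i) /\ \sum_(i < N) crd v i = 1 /\
  (forall i, A i i = 0 -> crd v i <= 3 / 4).

Definition equilibrium (v : 'rV[R]_N) : Prop := in_Delta v /\ Ffun v = 0.

Definition in_H0 (x : 'rV[R]_N) : Prop := \sum_(i < N) crd x i = 0.

(* lambda = p + i q is an eigenvalue of the linear map L restricted to the
   (invariant) hyperplane H0: there is a nonzero complex vector a + i b with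
   a, b in H0 and L(a + i b) = (p + i q)(a + i b), i.e.
   L a = p a - q b and L b = q a + p b. *)
Definition is_eigenvalue_on_H0 (L : 'rV[R]_N -> 'rV[R]_N) (p q : R) : Prop :=
  exists a b : 'rV[R]_N, (a != 0 \/ b != 0) /\ in_H0 a /\ in_H0 b /\
    L a = p *: a - q *: b /\ L b = q *: a + p *: b.

Definition linearly_stable (v : 'rV[R]_N) : Prop :=
  equilibrium v /\ differentiable Ffun v /\
  forall p q : R, is_eigenvalue_on_H0 ('d Ffun v) p q -> p < 0.

Definition supp (v : 'rV[R]_N) : set 'I_N := [set i | crd v i != 0].

Definition Zcount (x : nat -> 'I_N) (n : nat) (j : 'I_N) : nat :=
  \sum_(l < n.+1) (x l == j).

Definition trans_prob (x : nat -> 'I_N) (n : nat) (j : 'I_N) : R :=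
  A (x n) j * (1 + (Zcount x n j)%:R) `^ alpha /
  \sum_(k < N) A (x n) k * (1 + (Zcount x n k)%:R) `^ alpha.

Definition occ (x : nat -> 'I_N) (n : nat) : 'rV[R]_N :=
  \row_(i < N) ((Zcount x n i)%:R / n.+1%:R).

End VRRW.

(* The law of the process, through finite-dimensional distributions:
   P(X_0 = x_0, ..., X_{n+1} = x_{n+1})
     = P(X_0 = x_0, ..., X_n = x_n) * p_n(x_0..x_n ; x_{n+1}).
   The initial law is arbitrary. *)
Definition is_VRRW {R : realType} {N : nat} (alpha : R) (A : 'M[R]_N)
  {d : measure_display} {T : measurableType d} (P : probability T R)
  (X : nat -> T -> 'I_N) : Prop :=
  (forall n (i : 'I_N), measurable [set w | X n w = i]) /\
  forall (n : nat) (x : nat -> 'I_N),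
    P [set w | forall l, (l <= n.+1)%N -> X l w = x l] =
    (P [set w | forall l, (l <= n)%N -> X l w = x l] *
       (trans_prob alpha A x n (x n.+1))%:E)%E.

(* Main.v *)
(* Let i be outside the support of the limit v, L = n + 1 and z = 1 + Z_n(i).
   Since v lies in Delta, (A v^alpha)_j > 0 for every j, so on the event of
   convergence the normalising sum is eventually at least c L^alpha and
   P(X_{n+1} = i | F_n) <= C (z / L)^alpha, while z / L becomes as small as we
   wish.  As alpha > 1, the potential z^alpha / L^(alpha - 1) is then a
   supermartingale whose drift is at most -kappa P(X_{n+1} = i | F_n): the
   reinforcement raises z^alpha by a factor at most 1 + epsilon / L only, whereas
   the denominator grows by a factor about 1 + (alpha - 1) / L.  Telescoping the
   expectations, restricted to the trajectories that stay good from time m on,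
   shows that the probabilities of jumping to i are summable, and Borel-Cantelli
   concludes.  Expectations at time n are finite sums over the trajectories up
   to time n. *)
Require Import Defs.
From HB Require Import structures.
From mathcomp Require Import all_boot all_order all_algebra.
From mathcomp Require Import all_classical all_reals all_analysis.
From mathcomp Require Import ring lra.
Import Order.TTheory GRing.Theory Num.Theory.
Import numFieldNormedType.Exports.
Local Open Scope classical_set_scope.
Local Open Scope ring_scope.

(** * Power inequalities and the one-step drift of the potential *)

Lemma powR_succ_le (R : realType) (p z : R) : 1 <= p -> 1 <= z ->
  (z + 1) `^ p <= z `^ p + (2 `^ p - 1) * z `^ (p - 1).
Proof.
move=> p1 z1; have z0 : 0 < z := lt_le_trans ltr01 z1.
have t0 : 0 <= z^-1 by rewrite invr_ge0 ltW.
have t1 : z^-1 <= 1 by rewrite invf_le1.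
(* Convexity between 1 and 2 with weight [z^-1] gives $(1+1/z)^p \le 1+(2^p-1)/z$; it then remains
   to multiply by $z^p$. *)
have cvx := @convex_powR R p p1 (Itv01 t0 t1) (2 : R) (1 : R).
have {cvx} : (z^-1 * 2 + (1 - z^-1) * 1) `^ p <=
    z^-1 * 2 `^ p + (1 - z^-1) * 1 `^ p.
  by apply: cvx; rewrite inE /= in_itv /= andbT.
rewrite powR1 => le_cvx.
have -> : z + 1 = z * (z^-1 * 2 + (1 - z^-1) * 1) by field; rewrite gt_eqF.
rewrite powRM ?(ltW z0) //; last by lra.
apply: (le_trans (ler_wpM2l (powR_ge0 _ _) le_cvx)).
have -> : z `^ (p - 1) = z^-1 * z `^ p.
  by rewrite -(@mulr_powRB1 _ z p) ?(ltW z0) ?(lt_le_trans ltr01) // mulKf // gt_eqF.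
by rewrite le_eqVlt; apply/orP; left; apply/eqP; ring.
Qed.

(** Follows from $\ln(1-u)\le -u$ at $u=1/(L+1)$ and from $1+x\le e^x$. The quotient is $s/(L+1)$
    rather than $s/L$ because for $s<1$ concavity gives $(1+1/L)^s\le 1+s/L$. *)
Lemma powR_succ_ge (R : realType) (s L : R) : 0 <= s -> 1 <= L ->
  L `^ s * (1 + s / (L + 1)) <= (L + 1) `^ s.
Proof.
move=> s0 L1; have L0 : 0 < L := lt_le_trans ltr01 L1.
have L10 : 0 < L + 1 by lra.
have frac_lt1 : (L + 1)^-1 < 1 by rewrite invf_lt1 //; lra.
have ln_le : ln (1 - (L + 1)^-1) <= - (L + 1)^-1 by apply: le_ln1Dx; lra.
have -> : (L + 1) `^ s = L `^ s * expR (- (s * ln (1 - (L + 1)^-1))).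
  have {2}-> : L = (L + 1) * (1 - (L + 1)^-1) by field; rewrite gt_eqF.
  rewrite powRM ?(ltW L10) //; last by lra.
  rewrite -mulrA {3}/powR gt_eqF; last by lra.
  by rewrite -expRD subrr expR0 mulr1.
apply: ler_wpM2l; first exact: powR_ge0.
apply: (le_trans _ (expR_ge1Dx _)).
by rewrite lerD2l -mulrN; apply: ler_wpM2l => //; lra.
Qed.

(* The negative drift comes from (L + 1)^(alpha-1) >= L^(alpha-1) (1 + (alpha-1) / (L+1)),
   which beats the growth factor 1 + (alpha-1) / (8 L) of the numerator. *)
Lemma potential_drift (R : realType) (alpha C z L p : R) :
  1 < alpha -> 0 < C -> 1 <= z -> 1 <= L -> 0 <= p ->
  p <= C * (z / L) `^ alpha ->
  C * (2 `^ alpha - 1) * (z / L) `^ (alpha - 1) <= (alpha - 1) / 8 ->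
  ((1 - p) * z `^ alpha + p * (z + 1) `^ alpha) / (L + 1) `^ (alpha - 1)
    + (alpha - 1) / (4 * alpha * C) * p <= z `^ alpha / L `^ (alpha - 1).
Proof.
move=> a1 C0 z1 L1 p0 ple Hsmall; set s := alpha - 1.
have s0 : 0 < s by rewrite /s; lra.
have z0 : 0 < z := lt_le_trans ltr01 z1.
have L0 : 0 < L := lt_le_trans ltr01 L1.
have a0 : 0 < alpha by lra.
have zs0 : 0 < z `^ s by apply: powR_gt0.
have Ls0 : 0 < L `^ s by apply: powR_gt0.
have za : z `^ alpha = z * z `^ s by rewrite mulr_powRB1 // ltW.
have rE : (z / L) `^ s = z `^ s / L `^ s.
  by rewrite powRM ?invr_ge0 ?ltW // -powR_inv1 ?ltW // -powRrM mulN1r powRN.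
have raE : (z / L) `^ alpha = z / L * (z `^ s / L `^ s).
  by rewrite -rE mulr_powRB1 // divr_ge0 // ltW.
set r := z `^ s / L `^ s in rE raE.
have r0 : 0 < r by rewrite divr_gt0.
rewrite -/s rE in Hsmall.
have zsE : z `^ s = r * L `^ s by rewrite /r divfK // gt_eqF.
have K0 : 0 <= 2 `^ alpha - 1.
  rewrite subr_ge0; apply: (@le_trans _ _ (2 : R)); first by lra.
  by rewrite -{1}[2]powRr1 // ler_powR //; lra.
set K := 2 `^ alpha - 1 in Hsmall K0.
(* By [powR_succ_le] and the bound on [p], the expected gain is at most $(z^\alpha/L)\,CKr$ with
   $r=(z/L)^s$, and [Hsmall] says $CKr\le s/8$. *)
have num : (1 - p) * z `^ alpha + p * (z + 1) `^ alpha <=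
    z `^ alpha * (1 + s / 8 / L).
  have -> : (1 - p) * z `^ alpha + p * (z + 1) `^ alpha =
    z `^ alpha + p * ((z + 1) `^ alpha - z `^ alpha) by ring.
  rewrite [leRHS]mulrDr mulr1 lerD2l.
  apply: (@le_trans _ _ (C * (z / L * r) * (K * z `^ s))).
    apply: ler_pM => //; last by rewrite lerBlDl powR_succ_le // ltW.
      by rewrite subr_ge0 ge0_ler_powR // ?nnegrE ?ltW //; lra.
    by rewrite -raE.
  rewrite za.
  have -> : C * (z / L * r) * (K * z `^ s) = (z * z `^ s / L) * (C * K * r) by ring.
  have -> : z * z `^ s * (s / 8 / L) = (z * z `^ s / L) * (s / 8) by ring.
  by apply: ler_wpM2l => //; rewrite divr_ge0 ?mulr_ge0 // ltW.
have L10 : 0 < L + 1 by lra.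
have st0 : 0 < 1 + s / (L + 1) by rewrite addr_gt0 // divr_gt0.
have den := powR_succ_ge _ _ _ (ltW s0) L1.
have den0 : 0 < L `^ s * (1 + s / (L + 1)) by rewrite mulr_gt0.
have step1 : ((1 - p) * z `^ alpha + p * (z + 1) `^ alpha) / (L + 1) `^ s <=
    z `^ alpha * (1 + s / 8 / L) / (L `^ s * (1 + s / (L + 1))).
  apply: (@le_trans _ _ (z `^ alpha * (1 + s / 8 / L) / (L + 1) `^ s)).
    by apply: ler_wpM2r num; rewrite invr_ge0 powR_ge0.
  apply: ler_wpM2l; last by rewrite lef_pV2 ?posrE // (lt_le_trans den0).
  by rewrite mulr_ge0 ?powR_ge0 // addr_ge0 // !divr_ge0 // ltW.
have step2 : s / (4 * alpha * C) * p <= s / (4 * alpha) * (z / L * r).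
  rewrite -raE.
  apply: (@le_trans _ _ (s / (4 * alpha * C) * (C * (z / L) `^ alpha))).
    by apply: ler_wpM2l ple; rewrite divr_ge0 ?mulr_ge0 // ltW.
  by rewrite le_eqVlt; apply/orP; left; apply/eqP; field; rewrite !gt_eqF.
apply: (le_trans (lerD step1 step2)).
have -> : z `^ alpha * (1 + s / 8 / L) / (L `^ s * (1 + s / (L + 1))) =
   (z * r) * ((1 + s / 8 / L) / (1 + s / (L + 1))).
  by rewrite za zsE; field; rewrite !gt_eqF //; lra.
have -> : z `^ alpha / L `^ s = z * r by rewrite za -mulrA.
have -> : s / (4 * alpha) * (z / L * r) = (z * r) * (s / (4 * alpha) / L) by ring.
(* Once the common factor $zr=z^\alpha/L^s$ is removed, the claim is
   $(1+s/(8L))/(1+s/(L+1))+s/(4\alpha L)\le 1$. Since $1+s/(L+1)\le\alpha$, it reduces to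
   $3s/(8L)\le s/(L+1)$, a consequence of $1/L\le 2/(L+1)$. *)
rewrite -mulrDr -[leRHS]mulr1; apply: ler_wpM2l; first by rewrite mulr_ge0 // ltW.
rewrite -lerBrDr ler_pdivrMr //.
have hL : L^-1 <= 2 / (L + 1).
  rewrite ler_pdivlMr // -ler_pdivlMl ?invr_gt0 // invrK; lra.
set t := (L + 1)^-1 in hL *.
have t0 : 0 < t by rewrite invr_gt0.
have t1 : t <= 1 by rewrite invf_le1 //; lra.
have Li0 : 0 < L^-1 by rewrite invr_gt0.
have aE : alpha = 1 + s by rewrite /s; lra.
have ka : s / (4 * alpha) * (1 + s * t) <= s / 4.
  have -> : s / (4 * alpha) * (1 + s * t) = s / 4 * ((1 + s * t) / alpha).
    by field; rewrite gt_eqF.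
  rewrite -[leRHS]mulr1; apply: ler_wpM2l; first by lra.
  by rewrite ler_pdivrMr // aE mul1r lerD2l ler_piMr // ltW.
have kL : s / (4 * alpha) / L * (1 + s * t) <= s / 4 / L.
  have -> : s / (4 * alpha) / L * (1 + s * t) = s / (4 * alpha) * (1 + s * t) / L by ring.
  by apply: ler_wpM2r ka; exact: ltW.
have sL : s * L^-1 <= s * (2 * t) by apply: ler_wpM2l => //; exact: ltW.
rewrite [leRHS]mulrBl mul1r lerBrDr.
apply: (le_trans (lerD (lexx _) kL)).
have -> : 1 + s / 8 / L + s / 4 / L = 1 + 3 / 8 * (s * L^-1) by field; rewrite gt_eqF.
have st : 0 < s * t by rewrite mulr_gt0.
by lra.
Qed.

(** * Finitely many representatives of the trajectories up to a given time *)

Section Paths.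
Variable N : nat.
Implicit Types (x y : nat -> 'I_N) (n : nat) (j k : 'I_N).

Definition upd x n j : nat -> 'I_N := fun l => if l == n then j else x l.

(* One representative of each class of trajectories agreeing up to time [n]. *)
Fixpoint paths n : seq (nat -> 'I_N) :=
  if n is n'.+1 then [seq upd x n j | x <- paths n', j <- index_enum 'I_N]
  else [seq (fun=> j) | j <- index_enum 'I_N].

Lemma big_pathsS (R : nmodType) n (F : (nat -> 'I_N) -> R) :
  \sum_(x <- paths n.+1) F x = \sum_(x <- paths n) \sum_j F (upd x n.+1 j).
Proof. by rewrite /= big_allpairs_dep. Qed.

(** Spares naming the representative of [y]: the induction picks it one coordinate at a time and
    passes on to [Q] only its agreement with [y] up to time [n]. *)
Lemma paths_cover (T : Type) n y (Q : (nat -> 'I_N) -> set T) w :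
  (forall x, (forall l, (l <= n)%N -> x l = y l) -> Q x w) ->
  (\big[setU/set0]_(x <- paths n) Q x) w.
Proof.
elim: n Q => [|n IH] Q HQ.
  rewrite /= big_map (bigD1 (y 0%N)) //=; left; apply: HQ => l.
  by rewrite leqn0 => /eqP ->.
rewrite /= big_allpairs_dep; apply: IH => x Hx.
rewrite (bigD1 (y n.+1)) //=; left; apply: HQ => l.
by rewrite leq_eqVlt /upd => /predU1P[->|]; [rewrite eqxx|rewrite ltnS => ln; rewrite ltn_eqF ?ltnS // Hx].
Qed.

Lemma eq_Zcount x y n k :
  (forall l, (l <= n)%N -> x l = y l) -> Zcount x n k = Zcount y n k.
Proof. by move=> xy; apply: eq_bigr => l _; rewrite xy // -ltnS. Qed.

Lemma updE x n j l : (l <= n)%N -> upd x n.+1 j l = x l.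
Proof. by move=> ln; rewrite /upd ltn_eqF. Qed.

Lemma Zcount_upd x n j k :
  Zcount (upd x n.+1 j) n.+1 k = (Zcount x n k + (j == k))%N.
Proof.
rewrite {1}/Zcount big_ord_recr /= {2}/upd eqxx; congr addn.
by apply: (eq_Zcount (upd x n.+1 j) x) => l; apply: updE.
Qed.

End Paths.
Arguments upd {N}.

(** * Good trajectories and the drift of the potential along them *)

Section Potential.
Variables (R : realType) (N : nat) (alpha : R) (A : 'M[R]_N).
Hypothesis alpha1 : 1 < alpha.
Hypothesis A0 : forall i j, 0 <= A i j.
Variables (i : 'I_N) (B c delta : R).
Hypothesis B0 : 0 < B.
Hypothesis AB : forall j, A j i <= B.
Hypothesis c0 : 0 < c.
Hypothesis delta_small :
  B / c * (2 `^ alpha - 1) * delta `^ (alpha - 1) <= (alpha - 1) / 8.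
Implicit Types (x y : nat -> 'I_N) (m n : nat).

(** The first clause is $z/L\le\delta$; the second bounds the denominator of [trans_prob] from
    below. With [AB] and [delta_small] they give the hypotheses of [potential_drift] for $C=B/c$.
    Both read times up to [n] only, so they can be tested on [paths]. *)
Definition good n x : bool :=
  (1 + (Zcount x n i)%:R <= delta * n.+1%:R) &&
  (c * n.+1%:R `^ alpha <=
     \sum_(k < N) A (x n) k * (1 + (Zcount x n k)%:R) `^ alpha).

(** Does the work of a stopping time: as an indicator it cannot increase with [n], so inserting it
    into expectations preserves the supermartingale inequality for a nonnegative potential. *)
Definition good_from m n x : bool :=
  all (fun l => good l x) (index_iota m n.+1).

Definition potential n x : R :=
  (1 + (Zcount x n i)%:R) `^ alpha / n.+1%:R `^ (alpha - 1).

Lemma eq_good_from m n x y :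
  (forall l, (l <= n)%N -> x l = y l) -> good_from m n x = good_from m n y.
Proof.
move=> xy; apply: eq_in_all => l; rewrite mem_index_iota ltnS => /andP[_ ln].
have xyl k : (k <= l)%N -> x k = y k by move=> kl; apply/xy/(leq_trans kl).
rewrite /good (eq_Zcount _ x y) // xyl //; congr (_ && (_ <= _)).
by apply: eq_bigr => k _; rewrite (eq_Zcount _ x y).
Qed.

Lemma good_fromS m n x : (m <= n.+1)%N ->
  good_from m n.+1 x -> good_from m n x.
Proof.
move=> mn /allP gx; apply/allP => l; rewrite mem_index_iota => /andP[ml ln].
by apply: gx; rewrite mem_index_iota ml ltnW.
Qed.

Lemma good_from_last m n x : (m <= n)%N -> good_from m n x -> good n x.
Proof. by move=> mn /allP; apply; rewrite mem_index_iota mn ltnSn. Qed.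

Lemma potential_ge0 n x : 0 <= potential n x.
Proof. by rewrite divr_ge0 ?powR_ge0. Qed.

Lemma trans_prob_ge0 n x j : 0 <= trans_prob alpha A x n j.
Proof.
rewrite /trans_prob divr_ge0 ?mulr_ge0 ?powR_ge0 //.
by apply: sumr_ge0 => k _; rewrite mulr_ge0 ?powR_ge0.
Qed.

Let kappa : R := (alpha - 1) / (4 * alpha * (B / c)).

Lemma kappa_gt0 : 0 < kappa.
Proof. by rewrite /kappa divr_gt0 ?mulr_gt0 ?invr_gt0 //; have := alpha1; lra. Qed.

(** A jump to any $j\ne i$ leaves the visit count of $i$ unchanged, so the next potential takes only
    two values, with weights $1-p$ and $p$ as in [potential_drift]. *)
Lemma potential_step n x : good n x ->
  \sum_(j < N) trans_prob alpha A x n j * potential n.+1 (upd x n.+1 j)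
    + kappa * trans_prob alpha A x n i <= potential n x.
Proof.
move=> /andP[zle dge].
set z : R := 1 + (Zcount x n i)%:R in zle.
set L : R := n.+1%:R in zle dge.
set D := \sum_(k < N) _ in dge.
have L1 : 1 <= L by rewrite ler1n.
have L0 : 0 < L := lt_le_trans ltr01 L1.
have z1 : 1 <= z by rewrite lerDl.
have D0 : 0 < D by apply: lt_le_trans dge; rewrite mulr_gt0 ?powR_gt0.
have sum1 : \sum_(j < N) trans_prob alpha A x n j = 1.
  by rewrite /trans_prob -/D -mulr_suml divff // gt_eqF.
set p := trans_prob alpha A x n i.
have a0 : 0 < alpha by have := alpha1; lra.
have ple : p <= B / c * (z / L) `^ alpha.
  have -> : (z / L) `^ alpha = z `^ alpha / L `^ alpha.
    rewrite powRM ?invr_ge0 ?(le_trans ler01 z1) ?(ltW L0) //.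
    by rewrite -powR_inv1 ?(ltW L0) // -powRrM mulN1r powRN.
  rewrite /p /trans_prob -/D -/z.
  have -> : B / c * (z `^ alpha / L `^ alpha) = B * z `^ alpha / (c * L `^ alpha).
    by field; rewrite !gt_eqF // powR_gt0.
  apply: ler_pM; rewrite ?mulr_ge0 ?invr_ge0 ?powR_ge0 ?(ltW D0) //.
    by rewrite ler_wpM2r ?powR_ge0.
  by rewrite lef_pV2 // posrE // mulr_gt0 // powR_gt0.
have small : B / c * (2 `^ alpha - 1) * (z / L) `^ (alpha - 1) <= (alpha - 1) / 8.
  apply: le_trans delta_small; apply: ler_wpM2l.
    rewrite mulr_ge0 ?divr_ge0 ?(ltW B0) ?(ltW c0) // subr_ge0.
    apply: (@le_trans _ _ (2 : R)); first by lra.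
    by rewrite -{1}[2]powRr1 // ler_powR //; have := alpha1; lra.
  have zL0 : 0 <= z / L by rewrite divr_ge0 // ?(ltW L0) //; exact: le_trans z1.
  have zLd : z / L <= delta by rewrite ler_pdivrMr.
  apply: ge0_ler_powR => //; rewrite ?nnegrE //; last exact: le_trans zLd.
  by have := alpha1; lra.
have := potential_drift R alpha (B / c) z L p alpha1 (divr_gt0 B0 c0) z1 L1
  (trans_prob_ge0 _ _ _) ple small.
rewrite -/kappa; apply: le_trans; rewrite lerD2r.
rewrite le_eqVlt; apply/orP; left; apply/eqP.
have L1E : n.+2%:R = L + 1 by rewrite /L [RHS]addrC -natr1 addrC.
rewrite /potential (bigD1 i) //= -/p Zcount_upd eqxx addn1 -natr1 L1E.
rewrite (addrC _ 1) addrA -/z.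
rewrite (eq_bigr (fun j => trans_prob alpha A x n j *
    (z `^ alpha / (L + 1) `^ (alpha - 1)))); last first.
  by move=> j /negPf ji; rewrite Zcount_upd ji addn0.
rewrite -mulr_suml.
move: sum1; rewrite (bigD1 i) //= -/p => /(canRL (addKr _)) ->.
rewrite (_ : 1 + 1 + _ = z + 1); last by rewrite /z; ring.
by ring.
Qed.

(** * The law on finite trajectories, expectations and Borel-Cantelli *)

Section Law.
Context (d : measure_display) (T : measurableType d) (P : probability T R).
Variable X : nat -> T -> 'I_N.
Hypothesis HX : is_VRRW alpha A P X.

Definition cylinder n x : set T := [set w | forall l, (l <= n)%N -> X l w = x l].

Lemma measurable_cylinder n x : measurable (cylinder n x).
Proof.
elim: n => [|n IH].
  rewrite (_ : cylinder 0 x = [set w | X 0%N w = x 0%N]); first exact: HX.1.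
  apply/seteqP; split => w /= Hw; first exact: Hw.
  by move=> l; rewrite leqn0 => /eqP ->.
rewrite (_ : cylinder n.+1 x = cylinder n x `&` [set w | X n.+1 w = x n.+1]).
  by apply: measurableI => //; exact: HX.1.
apply/seteqP; split => w /=.
  by move=> Hw; split => [l ln|]; apply: Hw => //; exact: leqW.
by move=> [Hw Hn] l; rewrite leq_eqVlt => /predU1P[->//|]; rewrite ltnS; apply: Hw.
Qed.

Definition weight n x : R := fine (P (cylinder n x)).

Lemma weight_ge0 n x : 0 <= weight n x.
Proof. by rewrite /weight fine_ge0. Qed.

Lemma weightE n x : P (cylinder n x) = (weight n x)%:E.
Proof. by rewrite /weight fineK // fin_num_measure //; exact: measurable_cylinder. Qed.

(** The transition probability reads times up to [n] only, so overwriting time [n.+1] does not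
    change it. Here the recursion defining the law of the process enters. *)
Lemma weight_upd n x j :
  weight n.+1 (upd x n.+1 j) = weight n x * trans_prob alpha A x n j.
Proof.
apply: EFin_inj; rewrite -weightE /cylinder HX.2 [RHS]EFinM -weightE; congr (_ * _%:E)%E.
  by congr (P _); apply/seteqP; split => w /= Hw l ln; rewrite Hw // updE.
have updn : upd x n.+1 j n.+1 = j by rewrite /upd eqxx.
have Zupd k : Zcount (upd x n.+1 j) n k = Zcount x n k.
  by apply: eq_Zcount => l; exact: updE.
rewrite updn /trans_prob updE // Zupd; congr (_ / _).
by apply: eq_bigr => k _; rewrite Zupd.
Qed.

Definition mean_potential m n : R :=
  \sum_(x <- paths N n) (good_from m n x)%:R * weight n x * potential n x.

(** By [weight_upd], this is the probability of being good from [m] to [n] and then jumping to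
    [i]. *)
Definition mean_jump m n : R :=
  \sum_(x <- paths N n) (good_from m n x)%:R * weight n x * trans_prob alpha A x n i.

Lemma mean_potential_ge0 m n : 0 <= mean_potential m n.
Proof.
by apply: sumr_ge0 => x _; rewrite !mulr_ge0 ?potential_ge0 ?weight_ge0.
Qed.

(** The potential is nonnegative, so replacing the indicator up to [n.+1] by the one up to [n] can
    only enlarge the sum. Then [potential_step] applies path by path, $m\le n$ ensuring goodness at
    [n] itself. *)
Lemma mean_potential_step m n : (m <= n)%N ->
  mean_potential m n.+1 + kappa * mean_jump m n <= mean_potential m n.
Proof.
move=> mn; rewrite /mean_potential big_pathsS mulr_sumr -big_split /=.
apply: ler_sum => x _.
apply: (@le_trans _ _ ((good_from m n x)%:R * weight n x *
  (\sum_(j < N) trans_prob alpha A x n j * potential n.+1 (upd x n.+1 j)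
    + kappa * trans_prob alpha A x n i))).
  rewrite mulrDr; apply: lerD; last first.
    by rewrite le_eqVlt; apply/orP; left; apply/eqP; ring.
  rewrite mulr_sumr; apply: ler_sum => j _; rewrite weight_upd.
  have := potential_ge0 n.+1 (upd x n.+1 j).
  move: (potential _ _) => V V0.
  have := trans_prob_ge0 n x j; move: (trans_prob _ _ _ _ _) => p p0.
  rewrite !mulrA; apply: ler_wpM2r => //; apply: ler_wpM2r => //.
  apply: ler_wpM2r; first exact: weight_ge0.
  rewrite ler_nat; case gS: (good_from m n.+1 _) => //.
  have := good_fromS m n _ (leqW mn) gS.
  by rewrite (eq_good_from m n _ x) => [->|l]; last exact: updE.
case gx: (good_from m n x); last by rewrite !mul0r.
rewrite mul1r; apply: ler_wpM2l; first exact: weight_ge0.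
by apply: potential_step; exact: good_from_last gx.
Qed.

(** Telescoping from time [m], with the nonnegative last term dropped. The bound is free of [k],
    whence summability. *)
Lemma sum_mean_jump m k :
  \sum_(0 <= n < k) mean_jump m (m + n) <= mean_potential m m / kappa.
Proof.
have k0 := kappa_gt0; rewrite ler_pdivlMr // mulrC.
suff : mean_potential m (m + k) + kappa * (\sum_(0 <= n < k) mean_jump m (m + n))
   <= mean_potential m m by have := mean_potential_ge0 m (m + k); lra.
elim: k => [|k IH]; first by rewrite addn0 big_nil mulr0 addr0.
rewrite big_nat_recr //= mulrDr addnS.
have := mean_potential_step m (m + k) (leq_addr _ _); lra.
Qed.

(* A finite union of cylinders, hence measurable; see [jump_eventP] for its meaning. *)
Definition jump_event m n : set T :=
  \big[setU/set0]_(x <- paths N n)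
    (if good_from m n x then cylinder n.+1 (upd x n.+1 i) else set0).

Lemma jump_eventP m n w :
  good_from m n (fun l => X l w) -> X n.+1 w = i -> jump_event m n w.
Proof.
move=> gw Xi; apply: (@paths_cover _ _ n (fun l => X l w)) => x xw.
rewrite (eq_good_from m n x _ xw) gw => l.
rewrite leq_eqVlt => /predU1P[->|]; first by rewrite /upd eqxx.
by rewrite ltnS => ln; rewrite updE // xw.
Qed.

Lemma measurable_jump_event m n : measurable (jump_event m n).
Proof.
apply: bigsetU_measurable => x _.
by case: ifP => _ //; exact: measurable_cylinder.
Qed.

Lemma jump_event_le m n : (P (jump_event m n) <= (mean_jump m n)%:E)%E.
Proof.
rewrite /jump_event /mean_jump.
(* Measurability is carried through the induction because subadditivity of [P] asks for it. *)
suff : measurable (jump_event m n) /\ (P (jump_event m n) <= (mean_jump m n)%:E)%E by case.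
rewrite /jump_event /mean_jump.
apply: (big_rec2 (fun (S : set T) (r : R) => measurable S /\ (P S <= r%:E)%E)).
  by rewrite measure0.
move=> x S r _ [mS PS]; set E := if _ then _ else _.
have mE : measurable E by rewrite /E; case: ifP => _ //; exact: measurable_cylinder.
split; first exact: measurableU.
have leU : (P (E `|` S) <= P E + P S)%E := measureU2 P mE mS.
apply: (le_trans leU); rewrite EFinD; apply: leeD => //.
rewrite /E; case: ifP => _; last by rewrite measure0 !mul0r.
by rewrite weightE weight_upd mul1r.
Qed.

(** First Borel-Cantelli lemma. The index is shifted by [m] because the drift estimate starts at
    time [m]. *)
Lemma finitely_many_jumps m :
  P (lim_sup_set (fun n => jump_event m (m + n))) = 0%E.
Proof.
apply: lim_sup_set_cvg0 => [n|]; first exact: measurable_jump_event.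
apply: (@le_lt_trans _ _ (mean_potential m m / kappa)%:E); last exact: ltry.
apply: lime_le; first by apply: is_cvg_nneseries.
apply: nearW => k.
apply: (@le_trans _ _ (\sum_(0 <= n < k) mean_jump m (m + n))%:E); last first.
  by rewrite lee_fin sum_mean_jump.
by rewrite -sumEFin; apply: lee_sum => n _; exact: jump_event_le.
Qed.

End Law.
End Potential.

(** * From convergence of the occupation measure to good trajectories, and the conclusion *)

Lemma eventually_good (R : realType) (N : nat) (alpha : R) (A : 'M[R]_N)
  (x : nat -> 'I_N) (v : 'rV[R]_N) (i : 'I_N) (c delta : R) :
  0 < alpha -> (forall j k, 0 <= A j k) -> (forall k, 0 <= crd v k) ->
  crd v i = 0 -> 0 < delta ->
  (forall j, c <= \sum_(k < N) A j k * (crd v k / 2) `^ alpha) ->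
  occ R x n @[n --> \oo] --> v ->
  \forall n \near \oo, good R N alpha A i c delta n x.
Proof.
move=> a0 A0 v0 vi0 d0 cle xv.
have cvk k : occ R x n ord0 k @[n --> \oo] --> crd v k.
  exact: (cvg_comp _ _ xv (@coord_continuous R _ _ ord0 k v)).
(* Halving leaves strict room below the limit on the support; off the support the bound is 0 and
   holds trivially. *)
have lower : \forall n \near \oo, forall k,
    crd v k / 2 * n.+1%:R <= 1 + (Zcount x n k)%:R.
  apply: filter_forall => k; have := v0 k; rewrite le_eqVlt => /predU1P[<-|vk0].
    by apply: nearW => n; rewrite mul0r mul0r.
  have vk2 : crd v k / 2 < crd v k by lra.
  apply: filterS (cvgr_gt _ (cvk k) _ vk2) => n.
  by rewrite mxE ltr_pdivlMr // => /ltW /le_trans; apply; rewrite lerDr.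
have upper : \forall n \near \oo, occ R x n ord0 i < delta / 2.
  by apply: (cvgr_lt _ (cvk i)); rewrite vi0; lra.
(* From then on $1\le\delta n/2$, which absorbs the 1 in $1+Z_n(i)$; the other half of $\delta$
   bounds $Z_n(i)$. *)
have large : \forall n \near \oo, 2 / delta <= n%:R :> R by exact: nbhs_infty_ger.
apply: filterS3 lower upper large => n low up big; apply/andP; split.
  move: up; rewrite mxE ltr_pdivrMr // => /ltW h1.
  move: big; rewrite ler_pdivrMr // => h2.
  have nS : n.+1%:R = n%:R + 1 :> R by rewrite -natr1.
  by move: h1; rewrite !nS; lra.
apply: (@le_trans _ _ (\sum_(k < N) A (x n) k * (crd v k / 2 * n.+1%:R) `^ alpha)).
  apply: (le_trans (ler_wpM2r (powR_ge0 _ _) (cle (x n)))).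
  rewrite mulr_suml; apply: ler_sum => k _.
  by rewrite [in leRHS]powRM ?divr_ge0 // mulrA.
apply: ler_sum => k _; apply: ler_wpM2l => //; apply: ge0_ler_powR; rewrite ?nnegrE ?(ltW a0) //.
by rewrite mulr_ge0 ?divr_ge0.
Qed.

(** Either [v] charges some $k\ne j$, and $A_{j,k}>0$; or [v] is the unit mass at [j], and the
    constraint $v_j\le 3/4$ rules out $A_{j,j}=0$. *)
Lemma Delta_weight_gt0 (R : realType) (N : nat) (alpha : R) (A : 'M[R]_N)
  (v : 'rV[R]_N) (j : 'I_N) :
  (forall j k, 0 <= A j k) -> (forall j k, j != k -> 0 < A j k) ->
  in_Delta A v -> 0 < \sum_(k < N) A j k * (crd v k / 2) `^ alpha.
Proof.
move=> A0 Apos [v0 [v1 vdiag]].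
have [k Ajk vk] : exists2 k, 0 < A j k & 0 < crd v k.
  have [/existsP[k /andP[kj vk]]|/existsPn none] :=
    boolP [exists k, (k != j) && (0 < crd v k)].
    by exists k => //; apply: Apos; rewrite eq_sym.
  have vj : crd v j = 1.
    rewrite -v1 (bigD1 j) //= big1 ?addr0 // => k kj.
    by have := none k; rewrite kj /= lt_neqAle v0 andbT negbK => /eqP.
  exists j; last by rewrite vj.
  rewrite lt_neqAle A0 andbT eq_sym; apply/eqP => /vdiag; rewrite vj; lra.
rewrite (bigD1 k) //= ltr_pwDl ?mulr_gt0 ?powR_gt0 ?divr_gt0 //.
by apply: sumr_ge0 => l _; rewrite mulr_ge0 ?powR_ge0.
Qed.

Lemma finitely_many_visits (R : realType) (N : nat) (alpha : R) (A : 'M[R]_N)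
  (d : measure_display) (T : measurableType d) (P : probability T R)
  (X : nat -> T -> 'I_N) (v : 'rV[R]_N) (i : 'I_N) :
  1 < alpha -> (forall j k, 0 <= A j k) -> (forall j k, j != k -> 0 < A j k) ->
  is_VRRW alpha A P X -> in_Delta A v -> crd v i = 0 ->
  {ae P, forall w, (occ R (fun n => X n w) n @[n --> \oo] --> v) ->
     \forall n \near \oo, X n w != i}.
Proof.
move=> a1 A0 Apos HX vD vi0.
(* The minimum over finitely many [j] is positive; [i] serves to show the index set nonempty. *)
have [c c0 cle] : exists2 c : R, 0 < c &
    forall j, c <= \sum_(k < N) A j k * (crd v k / 2) `^ alpha.
  pose f j := \sum_(k < N) A j k * (crd v k / 2) `^ alpha.
  exists (f [arg min_(j < i) f j]%O); first exact: Delta_weight_gt0.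
  by move=> j; case: arg_minP => // k _; apply.
pose B := \sum_(j < N) A j i + 1.
have B0 : 0 < B by rewrite ltr_wpDl // sumr_ge0.
have AB j : A j i <= B.
  by rewrite /B (bigD1 j) //= -addrA lerDl addr_ge0 // sumr_ge0.
have two_le : (2 : R) <= 2 `^ alpha.
  by rewrite -{1}[2]powRr1 // ler_powR //; lra.
pose M := B / c * (2 `^ alpha - 1).
have M0 : 0 < M by rewrite mulr_gt0 ?divr_gt0 //; lra.
(* Solves the smallness condition [dsmall] with equality. *)
pose delta := ((alpha - 1) / 8 / M) `^ (alpha - 1)^-1.
have q0 : 0 < (alpha - 1) / 8 / M by rewrite divr_gt0 //; lra.
have d0 : 0 < delta by exact: powR_gt0.
have dsmall : M * delta `^ (alpha - 1) <= (alpha - 1) / 8.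
  rewrite /delta -powRrM mulVf; last by rewrite gt_eqF //; lra.
  by rewrite powRr1 ?(ltW q0) // mulrC divfK // gt_eqF.
pose J m := lim_sup_set (fun n => jump_event R N alpha A i c delta d T X m (m + n)).
have JN m : P.-negligible (J m).
  exists (J m); split => //.
    apply: bigcap_measurable => // k _; apply: bigcup_measurable => n _.
    exact: measurable_jump_event HX _ _.
  exact: finitely_many_jumps a1 A0 i B c delta B0 AB c0 dsmall d T P X HX m.
(* A convergent trajectory is good from some random [m] on, so infinitely many visits to [i] would
   put it in [J m]; the randomness of [m] costs only a countable union of null sets. *)
apply: (negligibleS _ (negligible_bigcup JN)) => w /=.
apply: contra_notP => nJ xv.
have [m _ gm] := eventually_good R N alpha A _ v i c delta
  (lt_trans ltr01 a1) A0 vD.1 vi0 d0 cle xv.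
have [k nk] : exists k, forall n, (k <= n)%N ->
    ~ jump_event R N alpha A i c delta d T X m (m + n) w.
  apply: contra_notP nJ => none; exists m => // k _.
  apply: contra_notP none => none; exists k => n kn jn.
  by apply: none; exists n.
(* The successor is there because a visit at time [n.+1] is a jump made at time [n], and $n\ge m+k$
   is needed. *)
exists (m + k).+1 => // -[//|n] /= lt_mkn; apply/eqP => Xi.
have mkn : (m + k <= n)%N by rewrite -ltnS.
have mn : (m <= n)%N := leq_trans (leq_addr k m) mkn.
apply: (nk (n - m)%N); first by rewrite leq_subRL.
rewrite subnKC //; apply: jump_eventP Xi.
apply/allP => l; rewrite mem_index_iota => /andP[ml _]; exact: gm.
Qed.

Theorem theorem3p12 (R : realType) (N : nat) (alpha : R) (A : 'M[R]_N)
  (HN : (2 <= N)%N) (Halpha : 1 < alpha)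
  (Asym : A^T = A) (Anneg : forall i j, 0 <= A i j)
  (Apos : forall i j, i != j -> 0 < A i j)
  (Arow : exists c : R, forall i, \sum_(j < N) A i j = c)
  (d : measure_display) (T : measurableType d) (P : probability T R)
  (X : nat -> T -> 'I_N) (HX : is_VRRW alpha A P X)
  (vstar : 'rV[R]_N) (Hstab : linearly_stable alpha A vstar) :
  {ae P, forall w,
     (occ R (fun n => X n w) n @[n --> \oo] --> vstar) ->
     exists m : nat, forall n : nat, (m <= n)%N -> supp vstar (X n w)}.
Proof.
have Dv : in_Delta A vstar := Hstab.1.1.
have visits i : crd vstar i = 0 ->
    {ae P, forall w, (occ R (fun n => X n w) n @[n --> \oo] --> vstar) ->
      \forall n \near \oo, X n w != i}.
  by move=> vi0; exact: finitely_many_visits Halpha Anneg Apos HX Dv vi0.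
(* The state space is finite, so the quantifier over [i] passes inside the almost sure statement,
   and later inside the eventual one; states in the support satisfy the implication vacuously. *)
have all_visits : {ae P, forall w i, crd vstar i = 0 ->
    (occ R (fun n => X n w) n @[n --> \oo] --> vstar) ->
    \forall n \near \oo, X n w != i}.
  apply: filter_forall => i.
  have [/visits|vi] := eqVneq (crd vstar i) 0; first by apply: filterS => w Hw _.
  by apply: nearW => w vi0; rewrite vi0 eqxx in vi.
apply: filterS all_visits => w Hw xv.
have : \forall n \near \oo, forall i, crd vstar i = 0 -> X n w != i.
  apply: filter_forall => i.
  have [vi0|vi] := eqVneq (crd vstar i) 0; first exact: filterS (Hw i vi0 xv).
  by apply: nearW => n vi0; rewrite vi0 eqxx in vi.
move=> [m _ Hm]; exists m => n mn; rewrite /supp /=.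
by apply/eqP => /(Hm n mn)/eqP.
Qed.
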